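(* Let $\mathcal G$ be a concave game in which $\Omega^p$ is compact for all $p\in\mathcal N$. Then, for every continuous trajectory $x^{-p}(t)$, $t\ge0$, of the opponents of player $p$, each player $p$ that uses the second-order mirror descent dynamics (MD2) $$\dot z^p=\gamma\big(U^p(x)-\alpha(x^p-\xi^p)\big),\qquad \dot\xi^p=\beta(x^p-\xi^p),\qquad x^p=C^p_\epsilon(z^p)$$ (with $\alpha,\beta,\gamma,\epsilon>0$ and $x(t)=(x^p(t);x^{-p}(t))$) achieves no-regret, independently from the rest of the players; that is, $\limsup_{t\to\infty}\mathcal R^p(t)\le0$, where $$\mathcal R^p(t)=\max_{y^p\in\Omega^p}\frac1t\int_0^t\Big[\mathcal U^p(y^p;x^{-p}(\tau))-\mathcal U^p(x(\tau))\Big]\,\mathrm d\tau,\qquad t>0.$$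
   Context: **Game.** $\mathcal N=\{1,\dots,N\}$ is the set of players; player $p$ has strategy set $\Omega^p\subseteq\mathbb R^{n_p}$ and payoff $\mathcal U^p:\Omega\to\mathbb R$, where $\Omega=\prod_p\Omega^p\subseteq\mathbb R^n$; $\Omega^{-p}$ denotes the product of the strategy sets of the other players, and $x=(x^p;x^{-p})$. The game is a *concave game* if for all $p$: $\Omega^p$ is non-empty, closed and convex; $\mathcal U^p$ is jointly continuous in $x$; and $\mathcal U^p(x^p;x^{-p})$ is concave and continuously differentiable in $x^p$ for all $x^{-p}\in\Omega^{-p}$. It is implicitly assumed that each $\mathcal U^p$ is defined and continuously differentiable on an open set containing $\Omega$. The partial gradient is $U^p(x)=\nabla_{x^p}\mathcal U^p(x^p;x^{-p})$. **Regularizer and mirror map.** $\vartheta^p:\mathbb R^{n_p}\to\mathbb R\cup\{\infty\}$ is closed, proper, convex with $\mathrm{dom}(\vartheta^p)=\Omega^p$, and is either (R-i) Legendre (strictly convex, steep, $\mathrm{int}(\mathrm{dom}\,\vartheta^p)\ne\emptyset$) and supercoercive ($\vartheta^p(x)/\|x\|\to\infty$ as $\|x\|\to\infty$), or (R-ii) $\rho$-strongly convex for some $\rho>0$. *Steep* means $\|\nabla\vartheta^p(x_k)\|_\star\to\infty$ (dual norm) whenever $(x_k)$ is a sequence in $\mathrm{rint}(\Omega^p)$ converging to a point of the (relative) boundary. For $\epsilon>0$ the mirror map is $C^p_\epsilon(z^p)=\mathrm{argmax}_{y^p\in\Omega^p}\big[{y^p}^\top z^p-\epsilon\vartheta^p(y^p)\big]$.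 The trajectory $(z^p(t),\xi^p(t))$, $t\ge0$, is a solution of the displayed system with arbitrary initial condition in $\mathbb R^{n_p}\times\mathbb R^{n_p}$. *)

(* Defs.v *)
From HB Require Import structures.
From mathcomp Require Import all_boot all_order all_algebra.
From mathcomp Require Import all_classical all_reals all_analysis.

Set Implicit Arguments.
Unset Strict Implicit.
Unset Printing Implicit Defensive.

Import Order.TTheory GRing.Theory Num.Theory.
Import numFieldNormedType.Exports.

Local Open Scope classical_set_scope.
Local Open Scope ring_scope.

Section EuclideanSpace.
Variables (R : realType) (n : nat).
Implicit Types (A : set 'rV[R]_n) (f : 'rV[R]_n -> R) (x y : 'rV[R]_n).

Definition dot x y : R := \sum_i x 0 i * y 0 i.

Definition gradient f x : 'rV[R]_n := \row_i 'D_(delta_mx 0 i) f x.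

(* f is a total function on the ambient space, so that the derivatives at the
   points of A, including those of its boundary, are two-sided. *)
Definition continuously_differentiable_on A f : Prop :=
  (forall x, A x -> differentiable f x) /\ {within A, continuous (gradient f)}.

Definition argmax (D : set 'rV[R]_n) (h : 'rV[R]_n -> \bar R) :
    set 'rV[R]_n :=
  [set y | D y /\ forall y', D y' -> (h y' <= h y)%E].

Definition affine_hull A : set 'rV[R]_n :=
  [set y | exists (k : nat) (a : 'I_k -> 'rV[R]_n) (c : 'I_k -> R),
    [/\ forall i, A (a i), \sum_i c i = 1 & y = \sum_i c i *: a i]].

Definition rel_interior A : set 'rV[R]_n :=
  [set x | A x /\ \forall y \near x, affine_hull A y -> A y].

Definition rel_boundary A : set 'rV[R]_n := closure A `\` rel_interior A.

Record is_norm (N : 'rV[R]_n -> R) : Prop := IsNorm {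
  is_norm_triangle : forall x y, N (x + y) <= N x + N y ;
  is_norm_scale : forall (a : R) x, N (a *: x) = `|a| * N x ;
  is_norm_eq0 : forall x, N x = 0 -> x = 0 }.

Definition dual_norm (N : 'rV[R]_n -> R) (z : 'rV[R]_n) : R :=
  sup [set dot z y | y in [set y | N y <= 1]].

End EuclideanSpace.

Section Regularizer.
Variables (R : realType) (n : nat).
Variables (nrm : 'rV[R]_n -> R) (theta : 'rV[R]_n -> \bar R).

Definition edom : set 'rV[R]_n := [set x | (theta x < +oo)%E].

Definition closed_fun : Prop :=
  closed [set xr : 'rV[R]_n * R | (theta xr.1 <= xr.2%:E)%E].

Definition proper_fun : Prop :=
  (forall x, theta x != -oo%E) /\ edom !=set0.

(* For theta > -oo the right-hand side is never of the form oo - oo. *)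
Definition convex_fun : Prop :=
  forall (x y : 'rV[R]_n) (l : R), 0 < l < 1 ->
    (theta (l *: x + (1 - l) *: y)
       <= l%:E * theta x + (1 - l)%:E * theta y)%E.

Definition strictly_convex_fun : Prop :=
  forall (x y : 'rV[R]_n) (l : R), edom x -> edom y -> x != y -> 0 < l < 1 ->
    (theta (l *: x + (1 - l) *: y)
       < l%:E * theta x + (1 - l)%:E * theta y)%E.

Definition strongly_convex_fun (rho : R) : Prop :=
  forall (x y : 'rV[R]_n) (l : R), edom x -> edom y -> 0 < l < 1 ->
    (theta (l *: x + (1 - l) *: y)
       <= l%:E * theta x + (1 - l)%:E * theta y
          - (rho / 2 * (l * (1 - l)) * nrm (x - y) ^+ 2)%:E)%E.

(* The gradient is the ambient one; steepness is only used below when the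
   domain has non-empty interior, so that the relative interior is open. *)
Definition steep : Prop :=
  (forall x, rel_interior edom x -> differentiable (fine \o theta) x) /\
  (forall (u : nat -> 'rV[R]_n) (a : 'rV[R]_n),
     (forall k, rel_interior edom (u k)) -> rel_boundary edom a ->
     u k @[k --> \oo] --> a ->
     dual_norm nrm (gradient (fine \o theta) (u k)) @[k --> \oo] --> +oo).

Definition legendre : Prop :=
  [/\ strictly_convex_fun, steep & (interior edom) !=set0].

Definition supercoercive : Prop :=
  forall M : R, exists r : R, forall x : 'rV[R]_n,
    r < nrm x -> (M%:E <= theta x * ((nrm x)^-1)%:E)%E.

Definition regularizer (Omega : set 'rV[R]_n) : Prop :=
  [/\ closed_fun, proper_fun, convex_fun, edom = Omega &
      (legendre /\ supercoercive) \/
      (exists rho : R, 0 < rho /\ strongly_convex_fun rho)].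

Definition mirror_map (Omega : set 'rV[R]_n) (eps : R) (z : 'rV[R]_n) :
    'rV[R]_n :=
  get (argmax Omega (fun y => (dot y z)%:E - eps%:E * theta y)%E).

End Regularizer.

Section Game.
Variables (R : realType) (N : nat) (n : 'I_N -> nat).

(* Joint strategies live in R^(n_1 + ... + n_N), cut into N blocks. *)
Definition joint := 'rV[R]_(\sum_(q < N) n q).

Definition strat (x : joint) (q : 'I_N) : 'rV[R]_(n q) := submxrow x q.

(* (y^p; x^{-p}): the p-th block of x is replaced, hence irrelevant. *)
Definition deviate (x : joint) (p : 'I_N) (y : 'rV[R]_(n p)) : joint :=
  \mxrow_(q < N) dfwith (strat x) p y q.

Variables (Omega : forall q : 'I_N, set 'rV[R]_(n q)).
Variables (payoff : 'I_N -> joint -> R).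
Arguments Omega : clear implicits.

Definition profiles : set joint := [set x | forall q, Omega q (strat x q)].

Definition opponents_feasible (p : 'I_N) (x : joint) : Prop :=
  forall q, q != p -> Omega q (strat x q).

(* Payoffs are total functions; their values outside of the open set O are
   irrelevant. *)
Record concave_game : Prop := ConcaveGame {
  cg_nonempty : forall p, (Omega p) !=set0 ;
  cg_closed : forall p, closed (Omega p) ;
  cg_convex : forall p, convex_set (Omega p) ;
  cg_continuous : forall p, {within profiles, continuous (payoff p)} ;
  cg_concave : forall p x, opponents_feasible p x ->
    convex_function (Omega p) (fun y => - payoff p (deviate x y)) ;
  cg_partialC1 : forall p x, opponents_feasible p x ->
    continuously_differentiable_on (Omega p)
      (fun y => payoff p (deviate x y)) ;
  cg_openC1 : forall p, exists O : set joint,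
    [/\ open O, profiles `<=` O & continuously_differentiable_on O (payoff p)]
}.

Definition partial_gradient (p : 'I_N) (x : joint) : 'rV[R]_(n p) :=
  gradient (fun y => payoff p (deviate x y)) (strat x p).

(* The time-continuous opponents' strategies are the blocks x^q, q != p, of the
   joint trajectory x.  The differential equations are required for t > 0
   together with the continuity at 0 of the state (z, xi); the one-sided
   equations at t = 0 then follow. *)
Definition opponents_trajectory (p : 'I_N) (x : R -> joint) : Prop :=
  (forall q, q != p -> {within `[0, +oo[, continuous (fun t => strat (x t) q)})
  /\ (forall t : R, 0 <= t -> opponents_feasible p (x t)).

Record MD2 (p : 'I_N) (theta : 'rV[R]_(n p) -> \bar R)
    (alpha beta gamma eps : R)
    (x : R -> joint) (z xi : R -> 'rV[R]_(n p)) : Prop := IsMD2 {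
  MD2_z_continuous : {within `[0, +oo[, continuous z} ;
  MD2_xi_continuous : {within `[0, +oo[, continuous xi} ;
  MD2_z : forall t : R, 0 < t ->
    is_derive t (1 : R) z (gamma *: (partial_gradient p (x t)
                               - alpha *: (strat (x t) p - xi t))) ;
  MD2_xi : forall t : R, 0 < t ->
    is_derive t (1 : R) xi (beta *: (strat (x t) p - xi t)) ;
  MD2_x : forall t : R, 0 <= t ->
    strat (x t) p = mirror_map theta (Omega p) eps (z t)
}.

(* The supremum is taken in the extended reals, where it always exists; it is
   the maximum as soon as the latter is attained. *)
Definition regret (p : 'I_N) (x : R -> joint) (t : R) : \bar R :=
  ereal_sup [set (t^-1 * \int[lebesgue_measure]_(tau in `[0, t])
                    (payoff p (deviate (x tau) y) - payoff p (x tau)))%:E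
            | y in Omega p].

Definition no_regret (p : 'I_N) (x : R -> joint) : Prop :=
  (limf_esup (regret p x) +oo%R <= 0)%E.

End Game.

(* Main.v *)
Require Import Defs.
From mathcomp Require Import all_boot all_order all_algebra.
From mathcomp Require Import all_classical all_reals all_analysis.
From mathcomp Require Import ring lra.

Import Order.TTheory GRing.Theory Num.Theory.
Import numFieldNormedType.Exports.

Local Open Scope classical_set_scope.
Local Open Scope ring_scope.

(** Fix a strategy y of player p, write psi(z) for the maximum over the strategy
    set of <y', z> - eps theta(y'), and consider along the trajectory the energy

      V(t) = (psi(z) - <y, z> + eps theta(y)) / gamma
             + alpha / (2 beta) |xi - y|^2,

    which is nonnegative because y competes in the maximum defining psi.  The
    gradient of psi is the mirror map (Danskin), so V has the derivative

      V' = <x^p - y, U^p(x)> - alpha |x^p - xi|^2 <= - <y - x^p, U^p(x)>,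

    and by concavity the instantaneous regret against y is at most
    <y - x^p, U^p(x)> <= - V'.  Integrating, the cumulative regret against y
    never exceeds V(0), and the time-averaged one never exceeds V(0) / t
    ([mirror_descent_bound]).

    The initial energy depends on theta(y), and a closed convex function that is
    finite on a compact convex set may be unbounded there, so this bound is not
    uniform in y.  Uniformity comes instead from the payoff: it is continuous on
    the compact set of profiles, so that the regret against y' exceeds the
    regret against y by little when y' is close to y, uniformly in time
    ([payoff_equicontinuous]); finitely many strategies y then control all.

    The analytic input is the continuity of the mirror map
    ([argmax_continuous]), which follows from compactness, lower semicontinuity
    of theta and strict convexity alone; it gives both the derivative of psi
    along the trajectory ([danskin]) and the continuity of the instantaneous
    regret, needed to differentiate its integral.  Trajectories are given on
    [0, +oo[ only; composing them with t |-> max 0 t makes them continuous on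
    the whole line without changing them for t >= 0. *)

(** * Inner product and gradient *)

Section Dot.
Context {R : realType} {n : nat}.
Implicit Types (x y z : 'rV[R]_n).

Lemma dotC x y : dot x y = dot y x.
Proof. by apply: eq_bigr => i _; rewrite mulrC. Qed.

Lemma dotDl x y z : dot (x + y) z = dot x z + dot y z.
Proof. by rewrite -big_split; apply: eq_bigr => i _; rewrite !mxE mulrDl. Qed.

Lemma dotZl a x y : dot (a *: x) y = a * dot x y.
Proof. by rewrite mulr_sumr; apply: eq_bigr => i _; rewrite !mxE mulrA. Qed.

Lemma dotBl x y z : dot (x - y) z = dot x z - dot y z.
Proof. by rewrite dotDl -scaleN1r dotZl mulN1r. Qed.

Lemma dotDr x y z : dot x (y + z) = dot x y + dot x z.
Proof. by rewrite dotC dotDl !(dotC x). Qed.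

Lemma dotZr a x y : dot x (a *: y) = a * dot x y.
Proof. by rewrite dotC dotZl dotC. Qed.

Lemma dotBr x y z : dot x (y - z) = dot x y - dot x z.
Proof. by rewrite dotC dotBl !(dotC x). Qed.

Lemma dot0l x : dot 0 x = 0.
Proof. by rewrite -(subrr 0) dotBl subrr. Qed.

Lemma dot_ge0 x : 0 <= dot x x.
Proof. by apply: sumr_ge0 => i _; rewrite -expr2 sqr_ge0. Qed.

Lemma cvg_dot {T : Type} {F : set_system T} {FF : Filter F}
    (f g : T -> 'rV[R]_n) (a b : 'rV[R]_n) :
  f t @[t --> F] --> a -> g t @[t --> F] --> b ->
  dot (f t) (g t) @[t --> F] --> dot a b.
Proof.
move=> fa gb; apply: cvg_big => [|i _]; first exact: add_continuous.
apply: cvgM.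
- exact: (cvg_comp _ _ fa (@coord_continuous _ _ _ 0 i a)).
- exact: (cvg_comp _ _ gb (@coord_continuous _ _ _ 0 i b)).
Qed.

Lemma derive_gradient (f : 'rV[R]_n -> R) x v : differentiable f x ->
  'D_v f x = dot v (gradient f x).
Proof.
move=> df; rewrite deriveE// {1}(row_sum_delta v) linear_sum /=.
by apply: eq_bigr => i _; rewrite linearZ /= mxE deriveE.
Qed.

(** A concave function lies below its tangent at x. *)
Lemma concave_gradient_ineq (D : set 'rV[R]_n) (f : 'rV[R]_n -> R) x y :
  convex_function D (fun u => - f u) -> D x -> D y -> differentiable f x ->
  f y - f x <= dot (y - x) (gradient f x).
Proof.
move=> cvxf Dx Dy df; rewrite -derive_gradient//.
(* The derivative along y - x is the limit from the right of the difference
   quotients, each of which is at least f y - f x by concavity. *)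
have dfv : derivable f x (y - x) by exact: diff_derivable.
have h0 : (h^-1 *: (f (h *: (y - x) + x) - f x)) @[h --> 0^'+] --> 'D_(y - x) f x.
  apply: cvg_trans dfv; apply: cvg_app; apply: within_subset => h /=.
  by rewrite lt_def => /andP[].
apply: (cvgr_to_ge h0); near=> h.
have h_gt0 : 0 < h by [].
have h_le1 : h <= 1 by near: h; exact: nbhs_right_le.
have /(_ (mem_set Dy) (mem_set Dx)) := cvxf (Itv01 (ltW h_gt0) h_le1) y x.
rewrite convRE /= /conv /=.
have -> : h *: y + (1 - h) *: x = h *: (y - x) + x.
  by rewrite scalerBr scalerBl scale1r addrA [RHS]addrAC.
rewrite /GRing.scale/= => H; rewrite -ler_pdivrMl ?invr_gt0// invrK.
by move: H; rewrite /unstable.onem; lra.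
Unshelve. all: by end_near. Qed.
End Dot.

(** * Derivatives of curves *)

Section ScalarDerivative.
Context {R : realType} {V : normedModType R}.

Lemma is_derive_cvg_quot (f : R -> V) (t : R) (l : V) : is_derive t 1 f l ->
  h^-1 *: (f (h + t) - f t) @[h --> 0^'] --> l.
Proof.
move=> [df <-]; move: df; rewrite /derivable /derive.
rewrite (_ : (fun h : R => h^-1 *: ((f \o shift t) h%:A - f t)) =
  (fun h => h^-1 *: (f (h + t) - f t)))//.
by apply/funext => h /=; rewrite [h%:A]mulr1.
Qed.

Lemma cvg_is_derive (f : R -> V) (t : R) (l : V) :
  h^-1 *: (f (h + t) - f t) @[h --> 0^'] --> l -> is_derive t 1 f l.
Proof.
rewrite (_ : (fun h => h^-1 *: (f (h + t) - f t)) =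
  (fun h : R => h^-1 *: ((f \o shift t) h%:A - f t))); last first.
  by apply/funext => h /=; rewrite [h%:A]mulr1.
by move=> fl; split; [apply/cvg_ex; exists l|exact/cvg_lim].
Qed.

Lemma is_derive_cvg_shift (f : R -> V) (t : R) (l : V) :
  is_derive t 1 f l -> f (h + t) @[h --> 0^'] --> f t.
Proof.
move=> Df; have ut : u + t @[u --> 0^'] --> t.
  rewrite -[X in _ --> X]add0r.
  by apply: cvgD; [exact: cvg_within|exact: cvg_cst].
have fc := differentiable_continuous
  (iffLR (derivable1_diffP _ _) (ex_derive (is_derive := Df))).
exact: (cvg_comp _ _ ut fc).
Qed.

End ScalarDerivative.

(** The product rule for the inner product of two curves. *)
Lemma is_derive_dot {R : realType} {n : nat} (a b : R -> 'rV[R]_n) (t : R) (da db : 'rV[R]_n) :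
  is_derive t 1 a da -> is_derive t 1 b db ->
  is_derive t (1 : R) (fun s => dot (a s) (b s)) (dot (a t) db + dot da (b t)).
Proof.
move=> Da Db; apply: cvg_is_derive.
have c1 : dot (a (h + t)) (h^-1 *: (b (h + t) - b t)) @[h --> 0^'] --> dot (a t) db.
  by apply: cvg_dot; [exact: is_derive_cvg_shift Da|exact: is_derive_cvg_quot].
have c2 : dot (h^-1 *: (a (h + t) - a t)) (b t) @[h --> 0^'] --> dot da (b t).
  by apply: cvg_dot; [exact: is_derive_cvg_quot|exact: cvg_cst].
have := cvgD c1 c2.
rewrite (_ : (_ + _) = (fun h : R =>
    h^-1 *: (dot (a (h + t)) (b (h + t)) - dot (a t) (b t))));
  first exact.
apply/funext => h /=; rewrite fctE dotZr dotZl dotBr dotBl /GRing.scale /=.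
ring.
Qed.

Lemma is_derive_comb3 {R : realType} (P Q S : R -> R) (a b c d t dP dQ dS : R) :
  is_derive t 1 P dP -> is_derive t 1 Q dQ -> is_derive t 1 S dS ->
  is_derive t 1 (fun s => a * P s + b * Q s + c * S s + d)
    (a * dP + b * dQ + c * dS).
Proof.
move=> DP DQ DS.
have := is_deriveD (is_deriveD (is_deriveD (is_deriveZ a DP) (is_deriveZ b DQ))
  (is_deriveZ c DS)) (is_derive_cst d t 1).
by rewrite addr0.
Qed.

(** If q is never farther from lo than up is, then q has the common limit of lo
    and up; lo and up need not be ordered consistently. *)
Lemma squeeze_cvgr_dist {R : realType} {T : Type} {F : set_system T} {FF : Filter F}
    (lo up q : T -> R) (l : R) :
  lo u @[u --> F] --> l -> up u @[u --> F] --> l ->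
  (\forall u \near F, `|q u - lo u| <= `|up u - lo u|) ->
  q u @[u --> F] --> l.
Proof.
move=> lol upl le_q.
have gap : `|up u - lo u| @[u --> F] --> (0 : R).
  by rewrite -(normr0 R) -(subrr l); apply: cvg_norm; exact: cvgB.
have lo' : lo u - `|up u - lo u| @[u --> F] --> l.
  by rewrite -[l]subr0; exact: cvgB.
have hi' : lo u + `|up u - lo u| @[u --> F] --> l.
  by rewrite -[l]addr0; exact: cvgD.
by apply: squeeze_cvgr lo' hi'; apply: filterS le_q => u; rewrite ler_distl.
Qed.

(** * Integrals of continuous functions over [0, T] *)

(** If V decreases at rate at least g, then the integral of g is at most the
    total decrease of V. *)
Lemma Rintegral_le_drop {R : realType} (T : R) (V dV g : R -> R) :
  0 < T -> continuous V -> continuous g ->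
  (forall t : R, 0 < t < T -> is_derive t 1 V (dV t)) ->
  (forall t : R, 0 < t < T -> g t <= - dV t) ->
  \int[lebesgue_measure]_(t in `[0, T]) g t <= V 0 - V T.
Proof.
move=> T0 cV cg DV gdV.
pose G t := \int[lebesgue_measure]_(s in `[0, t]) g s.
have ig : lebesgue_measure.-integrable `[0, T] (EFin \o g).
  apply: continuous_compact_integrable; first exact: segment_compact.
  exact: continuous_subspaceT.
have DG t : 0 < t < T -> is_derive t 1 G (g t).
  move=> /andP[t0 tT].
  have [|dG GE] := continuous_FTC1 (a := BLeft 0) tT ig _ (cg t).
    exact: t0.
  by split; [exact: dG|rewrite -derive1E].
have G0 : G 0 = 0 by rewrite /G set_itv1 Rintegral_set1.
have DVG t (t0T : 0 < t < T) : is_derive t 1 (V + G) (dV t + g t).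
  exact: (@is_deriveD _ _ _ _ _ _ _ _ _ (DV t t0T) (DG t t0T)).
(* The sum of V and the primitive G of g is nonincreasing. *)
have : (V + G) T <= (V + G) 0.
  apply: (@ler0_derive1_le_cc _ (V + G) 0 T); rewrite ?in_itv/= ?lexx ?(ltW T0)//.
  - by move=> t; rewrite in_itv/= => /DVG [].
  - move=> t; rewrite in_itv/= => t0T; have [_ E] := DVG t t0T.
    by rewrite derive1E E -lerBrDl sub0r gdV.
  - move=> t; apply: continuousD; first exact: (continuous_subspaceT cV).
    exact: (parameterized_integral_continuous (ltW T0) ig).
rewrite -[\int[_]_(_ in _) _]/(G T) lerBrDl.
by move=> /le_trans; apply; rewrite /= -[leLHS]/(V 0 + G 0) G0 addr0.
Qed.

Lemma Rintegral_le_addc {R : realType} (T c : R) (f g : R -> R) : 0 <= T ->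
  continuous f -> continuous g -> (forall t, f t <= g t + c) ->
  \int[lebesgue_measure]_(t in `[0, T]) f t <=
    \int[lebesgue_measure]_(t in `[0, T]) g t + T * c.
Proof.
move=> T0 cf cg fg.
have int (k : R -> R) : continuous k ->
    lebesgue_measure.-integrable `[0, T] (EFin \o k).
  move=> ck; apply: continuous_compact_integrable; first exact: segment_compact.
  exact: continuous_subspaceT.
have cc : continuous (fun _ : R => c) by exact: cst_continuous.
have -> : T * c = \int[lebesgue_measure]_(t in `[0, T]) c.
  rewrite Rintegral_cst//= lebesgue_measure_itv /= lte_fin.
  by have [|/(conj T0)/andP/le_anti <-] := ltP 0 T; rewrite /= ?subr0 1?mulrC// mul0r mulr0.
rewrite -RintegralD; [|by []|exact: int|exact: int].
apply: le_Rintegral => //; first exact: int.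
by apply: (int (fun t => g t + c)) => t; apply: cvgD; [exact: cg|exact: cvg_cst].
Qed.

(** * Semicontinuous maximization and continuity of the mirror map *)

(** An upper semicontinuous function attains its maximum on a compact set. *)
Lemma usc_compact_max {R : realType} {X : topologicalType} (K : set X) (h : X -> R) :
  compact K -> K !=set0 ->
  (forall y r, K y -> h y < r -> \forall y' \near y, K y' -> h y' < r) ->
  exists2 y, K y & forall y', K y' -> h y' <= h y.
Proof.
move=> cK [y0 Ky0] usc; apply: contrapT => nomax.
have bigger y : K y -> exists2 y1, K y1 & h y < h y1.
  move=> Ky; apply: contrapT => ny; apply: nomax; exists y => // y' Ky'.
  by rewrite leNgt; apply/negP => yy'; apply: ny; exists y'.
(* F is the filter of the sets that contain all y2 in K with h y2 at least some
   value of h on K.  Without a maximizer every y has a neighbourhood where h y' < h y2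
   for y2 along F; by compactness h y < h y2 would hold for all y in K at once,
   which is absurd for y = y2. *)
pose F : set_system X :=
  [set A | exists2 y1, K y1 & forall y2, K y2 -> h y1 <= h y2 -> A y2].
have FF : Filter F.
  split => [|A B [a Ka aA] [b Kb bB]|A B AB [a Ka aA]].
  - by exists y0.
  - have [ab|/ltW ba] := leP (h a) (h b).
    + by exists b => // y Ky hy; split; [apply: aA => //; exact: le_trans hy|exact: bB].
    + by exists a => // y Ky hy; split; [exact: aA|apply: bB => //; exact: le_trans hy].
  - by exists a => // y Ky hy; apply: AB; exact: aA.
have := (iffLR (compact_near_coveringP K) cK) X F
  (fun y2 y => K y -> h y < h y2) FF.
case=> [y Ky|y1 Ky1 H]; last by have := H y1 Ky1 (lexx _) y1 Ky1 Ky1; rewrite ltxx.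
have [y1 Ky1 yy1] := bigger y Ky.
exists ([set y' | K y' -> h y' < h y1], [set y2 | h y1 <= h y2]) => /=.
  by split; [exact: usc | exists y1].
by move=> [y' y2] /= [H1 H2] Ky'; exact: lt_le_trans (H1 Ky') H2.
Qed.

(** The function of y that the mirror map maximizes at the dual point z, for a
    regularizer f taking real values on the strategy set. *)
Definition mirror_objective {R : realType} {n : nat} (f : 'rV[R]_n -> R) (eps : R)
  (y z : 'rV[R]_n) : R := dot y z - eps * f y.

Section Mirror.
Context {R : realType} {n : nat}.
Variables (K : set 'rV[R]_n) (f : 'rV[R]_n -> R) (eps : R) (C : 'rV[R]_n -> 'rV[R]_n).
Hypothesis eps0 : 0 < eps.
Hypothesis cK : compact K.
Hypothesis lscf : forall y r, K y -> r < f y -> \forall y' \near y, K y' -> r < f y'.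
(* Convexity of K and strict convexity of f enter only through midpoints. *)
Hypothesis strictf : forall x y, K x -> K y -> x != y ->
  K (2^-1 *: x + 2^-1 *: y) /\ f (2^-1 *: x + 2^-1 *: y) < 2^-1 * f x + 2^-1 * f y.

Local Notation h := (mirror_objective f eps).

(** Upper semicontinuity holds jointly in the strategy and the dual point. *)
Lemma mirror_objective_usc y z r : K y -> h y z < r ->
  \forall y' \near y & z' \near z, K y' -> h y' z' < r.
Proof using eps0 lscf.
move=> Ky hr; set d := (r - h y z) / 2.
have d0 : 0 < d by rewrite /d divr_gt0// subr_gt0.
have H1 : \forall w \near (y, z), dot w.1 w.2 < dot y z + d.
  have : dot w.1 w.2 @[w --> (y, z)] --> dot y z.
    by apply: cvg_dot; [exact: cvg_fst|exact: cvg_snd].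
  by move/cvgr_lt; apply; rewrite ltrDl.
have H2 : \forall w \near (y, z), K w.1 -> f y - d / eps < f w.1.
  have /(lscf _ _ Ky) H : f y - d / eps < f y by rewrite ltrBlDr ltrDl divr_gt0.
  exact: (@cvg_fst _ _ (nbhs y) (nbhs z) _ _ H).
apply: filterS2 H1 H2 => -[y' z'] /= H1 H2 Ky'.
have {}H2 : eps * f y - d < eps * f y'.
  rewrite -(ltr_pM2l eps0) mulrBr mulrCA divff ?gt_eqF// mulr1 in H2.
  exact: H2.
rewrite /mirror_objective; move: H1 H2 hr; rewrite /d /mirror_objective; lra.
Qed.

(* C selects a maximizer for every dual point. *)
Hypothesis CK : forall z, K (C z).
Hypothesis C_max : forall z y, K y -> h y z <= h (C z) z.

Lemma argmax_unique y z : K y -> y != C z -> h y z < h (C z) z.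
Proof using CK C_max eps0 strictf.
move=> Ky yC; have [Km fm] := strictf _ _ Ky (CK z) yC.
rewrite lt_neqAle C_max// andbT; apply/negP => /eqP hh.
have := C_max z _ Km; move: hh fm; rewrite /mirror_objective dotDl !dotZl => hh.
rewrite -(ltr_pM2l eps0); lra.
Qed.

Lemma argmax_continuous : continuous C.
Proof using CK C_max cK eps0 lscf strictf.
move=> z B nB.
(* Each y in K other than C z has a neighbourhood whose points lose to C z at
   all dual points near z; by compactness C z' stays in any given neighbourhood
   B of C z when z' is close enough to z. *)
pose P z' y' := K y' -> B y' \/ h y' z' < h (C z) z'.
suff : \forall z' \near z, K `<=` P z'.
  apply: filterS => z' /(_ _ (CK z') (CK z')) [//|].
  by rewrite ltNge C_max.
have cov := iffLR (compact_near_coveringP K) cK _ _ P (nbhs_filter z).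
apply: cov => y Ky.
suff : \forall y' \near y & z' \near z, P z' y' by [].
have [->|yC] := eqVneq y (C z).
  have H : \forall w \near (C z, z), B w.1.
    exact: (@cvg_fst _ _ (nbhs (C z)) (nbhs z) _ _ nB).
  by apply: filterS H => -[y' z'] /= ? _; left.
have hlt := argmax_unique _ _ Ky yC.
set r := (h y z + h (C z) z) / 2.
have H1 : \forall y' \near y & z' \near z, K y' -> h y' z' < r.
  by apply: mirror_objective_usc => //; exact: (midf_lt hlt).1.
have H2 : \forall z' \near z, r < h (C z) z'.
  have : h (C z) z' @[z' --> z] --> h (C z) z.
    have cd : dot (C z) z' @[z' --> z] --> dot (C z) z.
      exact: (cvg_dot (F := nbhs z) _ _ _ _ (cvg_cst (C z)) cvg_id).
    exact: (cvgB cd (cvg_cst (eps * f (C z)))).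
  by move/cvgr_gt; apply; exact: (midf_lt hlt).2.
have {}H2 : \forall w \near (y, z), r < h (C z) w.2.
  exact: (@cvg_snd _ _ (nbhs y) (nbhs z) _ _ H2).
apply: filterS2 H1 H2 => -[y' z'] /= H1 H2 Ky'; right.
exact: lt_trans (H1 Ky') H2.
Qed.

(** C z is a subgradient at z of the convex function z |-> h (C z) z. *)
Lemma support_increment z z' :
  dot (C z) z' - dot (C z) z <= h (C z') z' - h (C z) z
    <= dot (C z') z' - dot (C z') z.
Proof using CK C_max.
have := C_max z' _ (CK z); have := C_max z _ (CK z').
by rewrite /mirror_objective => H1 H2; apply/andP; split; lra.
Qed.

Lemma support_continuous : continuous (fun z => h (C z) z).
Proof using CK C_max cK eps0 lscf strictf.
move=> z.
have lo : h (C z) z + (dot (C z) z' - dot (C z) z) @[z' --> z] --> h (C z) z.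
  rewrite -[X in _ --> X]addr0 -(subrr (dot (C z) z)).
  apply: (@cvgD _ R^o _ (nbhs z)); first exact: cvg_cst.
  apply: (@cvgB _ R^o _ (nbhs z)); last exact: cvg_cst.
  exact: (cvg_dot (F := nbhs z) _ _ _ _ (cvg_cst (C z)) cvg_id).
have up : h (C z) z + (dot (C z') z' - dot (C z') z) @[z' --> z] --> h (C z) z.
  rewrite -[X in _ --> X]addr0 -(subrr (dot (C z) z)).
  apply: (@cvgD _ R^o _ (nbhs z)); first exact: cvg_cst.
  apply: (@cvgB _ R^o _ (nbhs z)).
    exact: (cvg_dot (F := nbhs z) _ _ _ _ (@argmax_continuous z) cvg_id).
  exact: (cvg_dot (F := nbhs z) _ _ _ _ (@argmax_continuous z) (cvg_cst z)).
apply: (squeeze_cvgr_dist (F := nbhs z) _ _ _ _ lo up).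
apply: filterE => z'; have /andP[H1 H2] := support_increment z z'.
by rewrite !ger0_norm; lra.
Qed.

(** Along a differentiable curve z, the maximal value h (C z) z has the derivative
    obtained by keeping the maximizer fixed. *)
Lemma danskin (z : R -> 'rV[R]_n) (t : R) (dz : 'rV[R]_n) : is_derive t 1 z dz ->
  is_derive t (1 : R) (fun s => h (C (z s)) (z s)) (dot (C (z t)) dz).
Proof using CK C_max cK eps0 lscf strictf.
move=> Dz; apply: cvg_is_derive.
have qz := is_derive_cvg_quot _ _ _ Dz.
have zt := is_derive_cvg_shift _ _ _ Dz.
have lo : dot (C (z t)) (u^-1 *: (z (u + t) - z t)) @[u --> 0^'] --> dot (C (z t)) dz.
  by apply: cvg_dot => //; exact: cvg_cst.
have up : dot (C (z (u + t))) (u^-1 *: (z (u + t) - z t)) @[u --> 0^'] --> dot (C (z t)) dz.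
  apply: cvg_dot => //; exact: (cvg_comp _ _ zt (argmax_continuous _)).
apply: squeeze_cvgr_dist lo up _; near=> u.
rewrite !dotZr /GRing.scale /= !dotBr -!mulrBr !normrM ler_wpM2l//.
have /andP[H1 H2] := support_increment (z t) (z (u + t)).
by rewrite !ger0_norm ?subr_ge0 ?lerD2r//; exact: le_trans H1 H2.
Unshelve. all: by end_near. Qed.

(** The energy estimate for second-order mirror descent: g is any continuous
    function dominated by the linearized regret against y, the field u being
    arbitrary. *)
Lemma mirror_descent_bound (alpha beta gamma T : R) (y : 'rV[R]_n)
    (z xi u : R -> 'rV[R]_n) (g : R -> R) :
  0 < alpha -> 0 < beta -> 0 < gamma -> 0 < T -> K y ->
  continuous z -> continuous xi -> continuous g ->
  (forall t : R, 0 < t < T ->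
    is_derive t (1 : R) z (gamma *: (u t - alpha *: (C (z t) - xi t)))) ->
  (forall t : R, 0 < t < T ->
    is_derive t (1 : R) xi (beta *: (C (z t) - xi t))) ->
  (forall t : R, 0 < t < T -> g t <= dot (y - C (z t)) (u t)) ->
  \int[lebesgue_measure]_(t in `[0, T]) g t <=
    gamma^-1 * (h (C (z 0)) (z 0) - h y (z 0)) +
    alpha / (2 * beta) * dot (xi 0 - y) (xi 0 - y).
Proof using CK C_max cK eps0 lscf strictf.
move=> a0 b0 c0 T0 Ky cz cxi cg Dz Dxi gu.
pose V t := gamma^-1 * h (C (z t)) (z t) + (- gamma^-1) * dot y (z t)
  + alpha / (2 * beta) * dot (xi t - y) (xi t - y) + gamma^-1 * (eps * f y).
have VE t : V t = gamma^-1 * (h (C (z t)) (z t) - h y (z t)) +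
    alpha / (2 * beta) * dot (xi t - y) (xi t - y).
  by rewrite /V /mirror_objective; ring.
have V_ge0 t : 0 <= V t.
  rewrite VE addr_ge0// mulr_ge0 ?dot_ge0//.
  - by rewrite invr_ge0 ltW.
  - by rewrite subr_ge0 C_max.
  - by rewrite divr_ge0 ?mulr_ge0// ltW.
have cV : continuous V.
  move=> t; rewrite /V; apply: cvgD; last exact: cvg_cst.
  apply: cvgD; first apply: cvgD.
  - apply: cvgM; first exact: cvg_cst.
    exact: (cvg_comp _ _ (cz t) (@support_continuous (z t))).
  - apply: cvgM; first exact: cvg_cst.
    by apply: cvg_dot; [exact: cvg_cst|exact: cz].
  - apply: cvgM; first exact: cvg_cst.
    by apply: cvg_dot; (apply: cvgB; [exact: cxi|exact: cvg_cst]).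
rewrite -VE.
(* As V T >= 0, the initial energy bounds the decrease of V. *)
apply: (@le_trans _ _ (V 0 - V T)); last by rewrite gerBl.
pose dV t := gamma^-1 * dot (C (z t)) (gamma *: (u t - alpha *: (C (z t) - xi t)))
  + (- gamma^-1) * dot y (gamma *: (u t - alpha *: (C (z t) - xi t)))
  + alpha / (2 * beta) * (dot (xi t - y) (beta *: (C (z t) - xi t))
                        + dot (beta *: (C (z t) - xi t)) (xi t - y)).
apply: (@Rintegral_le_drop _ _ _ dV) => // t t0T.
- apply: is_derive_comb3.
  + exact: danskin (Dz t t0T).
  + have := is_derive_dot _ _ _ _ _ (is_derive_cst y t 1) (Dz t t0T).
    by rewrite dot0l addr0.
  + have Dxiy : is_derive t (1 : R) (fun s => xi s - y) (beta *: (C (z t) - xi t)).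
      rewrite -[X in is_derive _ _ _ X]subr0.
      exact: is_deriveB (Dxi t t0T) (is_derive_cst y t 1).
    exact: is_derive_dot.
- apply: (le_trans (gu t t0T)).
  have -> : - dV t = dot (y - C (z t)) (u t)
      + alpha * dot (C (z t) - xi t) (C (z t) - xi t).
    rewrite /dV !(dotZr, dotZl, dotBl, dotBr).
    rewrite (dotC (xi t) (C (z t))) (dotC y (C (z t))) (dotC y (xi t)).
    by field; rewrite !gt_eqF.
  by rewrite lerDl mulr_ge0 ?dot_ge0// ltW.
Qed.
End Mirror.

(** * Joint strategies *)

(** Convergence of row vectors is coordinatewise. *)
Lemma cvg_row {R : realType} {m : nat} {T : Type} {F : set_system T} {FF : Filter F}
    (f : T -> 'rV[R]_m) (a : 'rV[R]_m) :
  (forall j, f t 0 j @[t --> F] --> a 0 j) -> f t @[t --> F] --> a.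
Proof.
move=> fa P [Q nQ QP].
suff : \forall t \near F, forall j, Q 0 j (f t 0 j).
  by apply: filterS => t Qt; apply: QP => i j; rewrite ord1.
by apply: filter_forall => j; exact: (fa j _ (nQ 0 j)).
Qed.

Section Joint.
Context {R : realType} {N : nat} {n : 'I_N -> nat}.
Implicit Types x : joint R n.

Lemma strat_sig x j : strat x (tagnat.sig1 j) 0 (tagnat.sig2 j) = x 0 j.
Proof. by rewrite mxE tagnat.sig2K. Qed.

Lemma strat_continuous q : continuous (fun x => strat x q).
Proof.
move=> x; apply: (@cvg_row _ _ _ (nbhs x)) => j; rewrite mxE.
have -> : (fun x => strat x q 0 j) = (fun x => x 0 (tagnat.Rank q j)).
  by apply/funext => x'; rewrite mxE.
exact: coord_continuous.
Qed.

Lemma strat_deviate x p (y : 'rV[R]_(n p)) q :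
  strat (deviate x y) q = dfwith (strat x) p y q.
Proof. by rewrite /strat mxrowK. Qed.

Lemma deviate_strat x p : deviate x (strat x p) = x.
Proof.
apply/mxrowP => q; rewrite -/(strat _ q) strat_deviate.
by case: dfwithP.
Qed.

Lemma cvg_deviate {T : Type} {F : set_system T} {FF : Filter F} (p : 'I_N)
    (X : T -> joint R n) (Y : T -> 'rV[R]_(n p)) (x : joint R n) (y : 'rV[R]_(n p)) :
  (forall q, q != p -> strat (X t) q @[t --> F] --> strat x q) ->
  Y t @[t --> F] --> y ->
  deviate (X t) (Y t) @[t --> F] --> deviate x y.
Proof.
move=> Xx Yy; apply: cvg_row => j; rewrite mxE; under eq_fun do rewrite mxE.
move: (tagnat.sig1 j) (tagnat.sig2 j) => q k.
have [pq|qp] := eqVneq q p.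
  subst q; rewrite dfwithin; under eq_fun do rewrite dfwithin.
  exact: (cvg_comp _ _ Yy (@coord_continuous _ _ _ 0 k y)).
rewrite dfwithout 1?eq_sym//; under eq_fun do rewrite dfwithout 1?eq_sym//.
exact: (cvg_comp _ _ (Xx _ qp) (@coord_continuous _ _ _ 0 k _)).
Qed.

Section Profiles.
Variable Omega : forall q : 'I_N, set 'rV[R]_(n q).

Lemma profiles_deviate p x (y : 'rV[R]_(n p)) :
  opponents_feasible Omega p x -> Omega p y -> profiles Omega (deviate x y).
Proof.
move=> fx Oy q; rewrite strat_deviate.
have [pq|qp] := eqVneq q p; first by subst q; rewrite dfwithin.
by rewrite dfwithout 1?eq_sym//; exact: fx.
Qed.

Lemma compact_profiles : (forall q, compact (Omega q)) -> compact (profiles Omega).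
Proof.
move=> cO.
(* A j is the range of the j-th coordinate; the profiles form a closed subset of
   the product of these compact sets. *)
pose A j := (fun v : 'rV[R]_(n (tagnat.sig1 j)) => v 0 (tagnat.sig2 j)) @`
  Omega (tagnat.sig1 j).
have cA : compact [set v : joint R n | forall j, A j (v 0 j)].
  apply: rV_compact => j; apply: continuous_compact => //.
  by apply: continuous_subspaceT => v; exact: coord_continuous.
apply: subclosed_compact cA _; last first.
  by move=> x Ox j; exists (strat x (tagnat.sig1 j)) => //; exact: strat_sig.
rewrite (_ : profiles Omega =
    \bigcap_q ((fun x : joint R n => strat x q) @^-1` Omega q)); last first.
  by apply/seteqP; split => x Hx q; [move=> _|]; exact: Hx.
apply: closed_bigI => q _; apply: closed_comp; first by move=> x _; exact: strat_continuous.
exact: compact_closed.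
Qed.

(** For y' close to y, deviating to y' yields at most e more than deviating to y,
    whatever the profile. *)
Lemma payoff_equicontinuous (p : 'I_N) (u : joint R n -> R) (y : 'rV[R]_(n p)) (e : R) :
  compact (profiles Omega) -> (forall x, profiles Omega x -> {for x, continuous u}) ->
  Omega p y -> 0 < e ->
  \forall y' \near y, Omega p y' -> forall x, profiles Omega x ->
    u (deviate x y') - u (deviate x y) <= e.
Proof.
move=> cK cu Oy e0.
pose P y' x := Omega p y' -> profiles Omega x -> u (deviate x y') - u (deviate x y) <= e.
have cov := iffLR (compact_near_coveringP _) cK _ _ P (nbhs_filter y).
suff : \forall y' \near y, profiles Omega `<=` P y'.
  by apply: filterS => y' H Oy' x Kx; exact: H.
apply: cov => x Kx.
suff : \forall w \near (x, y), P w.2 w.1 by [].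
have Kxy : profiles Omega (deviate x y).
  by apply: profiles_deviate => // q _; exact: Kx.
have strat1 q : q != p ->
    strat w.1 q @[w --> (x, y)] --> strat x q.
  move=> _; apply: (cvg_comp (fun w : joint R n * 'rV[R]_(n p) => w.1) (fun x => strat x q)).
    exact: (@cvg_fst _ _ (nbhs x) (nbhs y)).
  exact: (@strat_continuous q x).
have c1 : u (deviate w.1 w.2) @[w --> (x, y)] --> u (deviate x y).
  apply: continuous_cvg; first exact: cu.
  apply: cvg_deviate; last exact: cvg_snd.
  exact: strat1.
have c2 : u (deviate w.1 y) @[w --> (x, y)] --> u (deviate x y).
  apply: continuous_cvg; first exact: cu.
  apply: cvg_deviate; last exact: cvg_cst.
  exact: strat1.
have e2 : 0 < e / 2 by rewrite divr_gt0.
have b1 : u (deviate x y) < u (deviate x y) + e / 2 by rewrite ltrDl.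
have b2 : u (deviate x y) - e / 2 < u (deviate x y) by rewrite ltrBlDr ltrDl.
have {}c1 : \forall w \near (x, y), u (deviate w.1 w.2) < u (deviate x y) + e / 2.
  exact: cvgr_lt c1 _ b1.
have {}c2 : \forall w \near (x, y), u (deviate x y) - e / 2 < u (deviate w.1 y).
  exact: cvgr_gt c2 _ b2.
apply: filterS2 c1 c2 => -[x' y'] /= H1 H2 _ _; lra.
Qed.
End Profiles.
End Joint.

(** * Regularizers on compact sets *)

Lemma cvg_pairl {X Y : topologicalType} (x : X) (y : Y) :
  (x', y) @[x' --> x] --> (x, y).
Proof. exact: (cvg_pair (F := nbhs x) cvg_id (cvg_cst y)). Qed.

Section RegularizerFacts.
Context {R : realType} {n : nat}.
Variables (nrm : 'rV[R]_n -> R) (theta : 'rV[R]_n -> \bar R).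
Variable (Omega : set 'rV[R]_n).
Hypothesis nrm_norm : is_norm nrm.
Hypothesis theta_reg : regularizer nrm theta Omega.

Lemma regularizer_fineK y : Omega y -> ((fine (theta y))%:E = theta y)%E.
Proof using theta_reg.
have [_ [ninf _] _ <- _] := theta_reg; move=> fin.
by rewrite fineK// fin_numE ninf lt_eqF.
Qed.

(** The epigraph of theta is closed, hence theta is lower semicontinuous. *)
Lemma regularizer_lsc y r : Omega y -> r < fine (theta y) ->
  \forall y' \near y, Omega y' -> r < fine (theta y').
Proof using theta_reg.
have [closed_epi _ _ _ _] := theta_reg; move=> Oy ry.
have : nbhs (y, r) (~` [set xr : 'rV[R]_n * R | (theta xr.1 <= xr.2%:E)%E]).
  apply: open_nbhs_nbhs; split; first exact: (closed_openC closed_epi).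
  by rewrite /= -(regularizer_fineK _ Oy) lee_fin leNgt ry.
have cr : (y', r) @[y' --> y] --> (y, r) by exact: cvg_pairl.
move/cr; rewrite nbhs_simpl /=; apply: filterS => y' /= /negP H Oy'.
by move: H; rewrite -(regularizer_fineK _ Oy') lee_fin -ltNge.
Qed.

(** Both kinds of regularizers are strictly convex at midpoints; steepness and
    supercoercivity play no role on a compact domain. *)
Lemma regularizer_midpoint x y : Omega x -> Omega y -> x != y ->
  Omega (2^-1 *: x + 2^-1 *: y) /\
  fine (theta (2^-1 *: x + 2^-1 *: y)) < 2^-1 * fine (theta x) + 2^-1 * fine (theta y).
Proof using nrm_norm theta_reg.
move=> Ox Oy xy; have [_ _ _ domE strict] := theta_reg.
have half01 : 0 < (2^-1 : R) < 1 by apply/andP; split; lra.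
have halfC : 1 - 2^-1 = 2^-1 :> R by lra.
suff lt_mid : (theta (2^-1 *: x + 2^-1 *: y) <
    (2^-1 * fine (theta x) + 2^-1 * fine (theta y))%:E)%E.
  have Om : Omega (2^-1 *: x + 2^-1 *: y).
    by rewrite -domE; apply: lt_trans lt_mid _; exact: ltry.
  by split => //; rewrite -lte_fin regularizer_fineK.
have [[[sc _ _] _]|[rho [rho0 sc]]] := strict.
  have := sc x y _ _ _ xy half01; rewrite domE halfC => /(_ Ox Oy).
  by rewrite -(regularizer_fineK _ Ox) -(regularizer_fineK _ Oy).
have := sc x y _ _ _ half01; rewrite domE halfC => /(_ Ox Oy) /le_lt_trans; apply.
rewrite -(regularizer_fineK _ Ox) -(regularizer_fineK _ Oy) -!EFinM -!EFinD lte_fin.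
have nxy : 0 < nrm (x - y) ^+ 2.
  rewrite exprn_even_gt0//=; apply: contraNneq xy => /(is_norm_eq0 nrm_norm)/eqP.
  by rewrite subr_eq0.
by rewrite ltrBlDr ltrDl mulr_gt0// mulr_gt0 ?divr_gt0// mulr_gt0 ?invr_gt0.
Qed.

(** The argmax defining the mirror map is not empty. *)
Lemma mirror_map_argmax (eps : R) z : 0 < eps -> compact Omega ->
  Omega (mirror_map theta Omega eps z) /\
  forall y, Omega y -> mirror_objective (fine \o theta) eps y z <=
    mirror_objective (fine \o theta) eps (mirror_map theta Omega eps z) z.
Proof using theta_reg.
move=> eps0 cO.
have objE y : Omega y ->
    ((dot y z)%:E - eps%:E * theta y = (mirror_objective (fine \o theta) eps y z)%:E)%E.
  by move=> Oy; rewrite -(regularizer_fineK _ Oy).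
have nonempty : Omega !=set0.
  by have [_ [_ ?] _ <- _] := theta_reg.
have [|ymax Oymax ymaxP] := usc_compact_max Omega
    (fun y => mirror_objective (fine \o theta) eps y z) cO nonempty.
  move=> y r Oy yr.
  have := mirror_objective_usc Omega (fine \o theta) eps eps0 regularizer_lsc _ _ _ Oy yr.
  have cz : (y', z) @[y' --> y] --> (y, z) by exact: cvg_pairl.
  by move/cz.
have [Om Hm] : argmax Omega (fun y => (dot y z)%:E - eps%:E * theta y)%E
    (mirror_map theta Omega eps z).
  apply: getPex; exists ymax; split => // y Oy.
  by rewrite !objE// lee_fin ymaxP.
by split=> // y Oy; rewrite -lee_fin -!objE// Hm.
Qed.
End RegularizerFacts.

(** * No regret *)

(** A function that is continuous on [0, +oo[, extended by its value at 0. *)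
Lemma continuous_clamp {R : realType} {T : topologicalType} (f : R -> T) :
  {within `[0, +oo[, continuous f} -> continuous (fun t : R => f (Num.max 0 t)).
Proof.
move=> /subspace_continuousP cf s.
have ms : Num.max (0 : R) t @[t --> s] --> Num.max 0 s.
  by apply: continuous_max => //; exact: cvg_cst.
have m0 : `[0, +oo[%classic (Num.max 0 s).
  by rewrite /= in_itv /= andbT le_max lexx.
apply: (cvg_comp (fun t : R => Num.max 0 t) f _ (cf _ m0)) => P /= nP.
have H : \forall t \near s, `[0, +oo[%classic (Num.max 0 t) -> P (Num.max 0 t) := ms _ nP.
suff : \forall t \near s, P (Num.max 0 t) by [].
apply: filterS H => t; apply.
by rewrite /= in_itv /= andbT le_max lexx.
Qed.

Theorem theorem3 (R : realType) (N : nat) (n : 'I_N -> nat)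
    (Omega : forall q : 'I_N, set 'rV[R]_(n q))
    (payoff : 'I_N -> joint R n -> R)
    (game : concave_game Omega payoff)
    (Omega_compact : forall q, compact (Omega q))
    (p : 'I_N)
    (nrm : 'rV[R]_(n p) -> R) (nrm_norm : is_norm nrm)
    (theta : 'rV[R]_(n p) -> \bar R)
    (theta_reg : regularizer nrm theta (Omega p))
    (alpha beta gamma eps : R)
    (alpha0 : 0 < alpha) (beta0 : 0 < beta)
    (gamma0 : 0 < gamma) (eps0 : 0 < eps)
    (x : R -> joint R n) (z xi : R -> 'rV[R]_(n p)) :
  opponents_trajectory Omega p x ->
  MD2 Omega payoff theta alpha beta gamma eps x z xi ->
  no_regret Omega payoff p x.
Proof.
move=> [opp_continuous opp_feasible] dynamics.
pose f := fine \o theta.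
pose C := mirror_map theta (Omega p) eps.
have cK := Omega_compact p.
have lscf := regularizer_lsc _ _ _ theta_reg.
have midf := regularizer_midpoint _ _ _ nrm_norm theta_reg.
have CK w : Omega p (C w) := (mirror_map_argmax _ _ _ theta_reg eps w eps0 cK).1.
have C_max w y : Omega p y -> mirror_objective f eps y w <= mirror_objective f eps (C w) w :=
  (mirror_map_argmax _ _ _ theta_reg eps w eps0 cK).2 y.
have C_continuous := argmax_continuous _ f _ _ eps0 cK lscf midf CK C_max.
pose X (t : R) := x (Num.max 0 t).
pose Z (t : R) := z (Num.max 0 t).
pose Xi (t : R) := xi (Num.max 0 t).
have cZ : continuous Z := continuous_clamp _ (MD2_z_continuous dynamics).
have cXi : continuous Xi := continuous_clamp _ (MD2_xi_continuous dynamics).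
have max0 (t : R) : 0 <= Num.max 0 t by rewrite le_max lexx.
have XE t : 0 <= t -> X t = x t by move=> t0; rewrite /X max_r.
have stratX t : strat (X t) p = C (Z t) := MD2_x dynamics (max0 t).
have X_opp t : opponents_feasible Omega p (X t) := opp_feasible _ (max0 t).
have X_profile t : profiles Omega (X t).
  by rewrite -(deviate_strat (X t) p) stratX; exact: profiles_deviate.
have cXy (Y : R -> 'rV[R]_(n p)) : continuous Y ->
    continuous (fun t => deviate (X t) (Y t)).
  move=> cY t; apply: cvg_deviate; last exact: cY.
  by move=> q qp; exact: (continuous_clamp _ (opp_continuous q qp)).
have cX : continuous X.
  have -> : X = fun t => deviate (X t) (C (Z t)).
    by apply/funext => t; rewrite -stratX deviate_strat.
  by apply: cXy => t; exact: (cvg_comp _ _ (cZ t) (C_continuous (Z t))).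
(* On the open set O of the game the payoff is differentiable, so that its
   continuity at profiles holds in full neighbourhoods. *)
have payoff_continuous w : profiles Omega w -> {for w, continuous (payoff p)}.
  have [W [_ KW [dW _]]] := cg_openC1 game p.
  by move=> Kw; apply: differentiable_continuous; exact/dW/KW.
pose g (y : 'rV[R]_(n p)) (t : R) := payoff p (deviate (X t) y) - payoff p (X t).
have g_continuous y : Omega p y -> continuous (g y).
  move=> Oy t; apply: (@cvgB _ R^o).
  - apply: (cvg_comp _ _ (cXy (fun=> y) _ t)); first exact: cst_continuous.
    by apply: payoff_continuous; exact: profiles_deviate.
  - by apply: (cvg_comp _ _ (cX t)); exact: payoff_continuous.
have clampE (V : normedModType R) (h : R -> V) (t : R) l : 0 < t ->
    is_derive t 1 h l -> is_derive t 1 (fun s => h (Num.max 0 s)) l.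
  move=> t0; apply: near_eq_is_derive; near=> s.
  rewrite max_r// ltW//; near: s; exact: lt_nbhsr.
(* The cumulative regret against a fixed y is bounded by the initial energy. *)
have bound y : Omega p y -> exists B, forall T, 0 < T ->
    \int[lebesgue_measure]_(t in `[0, T]) g y t <= B.
  move=> Oy; eexists => T T0.
  apply: (mirror_descent_bound _ f _ _ eps0 cK lscf midf CK C_max alpha beta gamma
    T y Z Xi (fun t => partial_gradient payoff p (X t))) => //.
  - exact: g_continuous.
  - move=> t /andP[t0 _]; rewrite -stratX /Xi /Z /X max_r ?(ltW t0)//.
    exact: clampE (MD2_z dynamics t0).
  - move=> t /andP[t0 _]; rewrite -stratX /Xi /X max_r ?(ltW t0)//.
    exact: clampE (MD2_xi dynamics t0).
  - move=> t _; rewrite -stratX /g -{2}(deviate_strat (X t) p).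
    have Op : Omega p (strat (X t) p) by exact: X_profile.
    apply: (concave_gradient_ineq _ _ _ _ (cg_concave game (X_opp t)) Op Oy).
    exact: (cg_partialC1 game (X_opp t)).1.
apply/lee_addgt0Pr => e e0; rewrite add0e.
pose avg (t : R) (y : 'rV[R]_(n p)) := t^-1 * \int[lebesgue_measure]_(s in `[0, t])
  (payoff p (deviate (x s) y) - payoff p (x s)).
(* Every strategy y has a neighbourhood of strategies whose averaged regret is at
   most e / 2 plus that of y, itself at most B / t; compactness makes the time
   after which the sum is below e uniform. *)
have small : \forall t \near +oo, Omega p `<=` [set y | Omega p y -> avg t y <= e].
  pose P t y := Omega p y -> avg t y <= e.
  suff : \forall t \near +oo, Omega p `<=` P t by [].
  have e2 : 0 < e / 2 by rewrite divr_gt0.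
  apply: (iffLR (compact_near_coveringP _) cK _ _ P) => y Oy.
  have [B boundB] := bound y Oy.
  have equi := payoff_equicontinuous Omega _ _ y (e / 2)
    (compact_profiles _ Omega_compact) payoff_continuous Oy e2.
  exists ([set y' | Omega p y' -> forall w, profiles Omega w ->
      payoff p (deviate w y') - payoff p (deviate w y) <= e / 2],
    [set t : R | 0 < t /\ B / (e / 2) <= t]) => /=.
    split; first exact: equi.
    by apply: filterI; [exact: nbhs_pinfty_gt|exact/nbhs_pinfty_ge/num_real].
  move=> [y' t] /= [close [t0 tB]] Oy'.
  rewrite /avg ler_pdivrMl//.
  have -> : \int[lebesgue_measure]_(s in `[0, t])
      (payoff p (deviate (x s) y') - payoff p (x s)) =
      \int[lebesgue_measure]_(s in `[0, t]) g y' s.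
    by apply: eq_Rintegral => s; rewrite inE /= in_itv /= => /andP[s0 _]; rewrite /g XE.
  have le_g : \int[lebesgue_measure]_(s in `[0, t]) g y' s <=
      \int[lebesgue_measure]_(s in `[0, t]) g y s + t * (e / 2).
    apply: Rintegral_le_addc; [exact: ltW|exact: g_continuous|exact: g_continuous|].
    by move=> s; have := close Oy' _ (X_profile s); rewrite /g; lra.
  apply: (le_trans le_g); rewrite [leRHS](_ : _ = t * (e / 2) + t * (e / 2)).
    by rewrite lerD2r (le_trans (boundB t t0))// -ler_pdivrMr.
  by rewrite -mulrDr -splitr.
apply: (@le_trans _ _ (ereal_sup (regret Omega payoff p x @`
    [set t | Omega p `<=` [set y | Omega p y -> avg t y <= e]]))).
  by apply: ereal_inf_lbound; eexists; [exact: small|].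
apply: ub_ereal_sup => _ [t /= Ht <-]; apply: ub_ereal_sup => _ [y Oy <-].
by rewrite lee_fin; exact: Ht.
Unshelve. all: by end_near. Qed.
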